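(* Let $K$ be a compact Hausdorff space of weight $w(K)\le\omega_1$, and let $X$ be a topological space homeomorphic to a subspace of $C_p(K)$. If $X$ is locally compact and scattered, of height lower than $\omega_1\cdot\omega_1$ (ordinal product), then $X$ is $\sigma$-discrete.
   Context: $C_p(K)$ is the set of all continuous functions $K\to\mathbb{R}$ with the topology of pointwise convergence (inherited from $\mathbb{R}^K$). The weight $w(K)$ is the least infinite cardinality of a base of $K$. A space is Eberlein-Grothendieck if it is homeomorphic to a subspace of $C_p(K)$ for some compact space $K$. A space is scattered if every nonempty subspace of it has an isolated point. For a scattered space $X$, the $\alpha$-th scattering level $X^{(\alpha)}$ is the set of isolated points of $X\setminus\bigcup_{\beta<\alpha}X^{(\beta)}$; the height of $X$ is the least ordinal $\alpha$ with $X^{(\alpha)}=\varnothing$. A space is $\sigma$-discrete if it is the union of countably many subspaces each of which is discrete in its relative topology. *)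

(* Defs.v *)
From HB Require Import structures.
From mathcomp Require Import all_boot all_order all_algebra.
From mathcomp Require Import all_classical all_reals all_analysis.

Set Implicit Arguments.
Unset Strict Implicit.
Unset Printing Implicit Defensive.

Import Order.TTheory GRing.Theory Num.Theory numFieldNormedType.Exports.

Local Open Scope classical_set_scope.
Local Open Scope card_scope.

(* ω₁ is built as the set of those points of a fixed well-ordering of the
   uncountable type [set nat] that have only countably many predecessors;
   the lemmas below show that it has order type ω₁. *)
Definition wo_rel : rel (set nat) := projT1 (wochoice.well_ordering_principle (set nat)).

Lemma wo_relP : wochoice.well_order wo_rel.
Proof. exact: projT2 (wochoice.well_ordering_principle (set nat)). Qed.

Definition omega1_set : set (set nat) :=
  [set x | countable [set y | wo_rel y x]].

Definition omega1 : Type := set_type omega1_set.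

HB.instance Definition _ := Choice.on omega1.

Definition omega1_le (x y : omega1) : bool := wo_rel (val x) (val y).

Lemma wo_relT : wochoice.wo_chain wo_rel predT.
Proof. by move=> A _; exact: wo_relP. Qed.

Lemma wo_rel_total : total wo_rel.
Proof. by move=> x y; apply: (wochoice.wo_chainW wo_relT). Qed.

Lemma wo_rel_refl : reflexive wo_rel.
Proof. by move=> x; apply: (wochoice.wo_chain_reflexive wo_relT). Qed.

Lemma wo_rel_anti : antisymmetric wo_rel.
Proof. by move=> x y; apply: (wochoice.wo_chain_antisymmetric wo_relT). Qed.

Lemma wo_rel_min (A : set (set nat)) :
  A !=set0 -> exists2 x, A x & forall y, A y -> wo_rel x y.
Proof.
move=> [x Ax].
have [|z [[zA zle] _]] := wo_relP (A := mem A).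
  by exists x; exact/mem_set.
exists z; first exact: set_mem.
by move=> y Ay; apply: zle; exact/mem_set.
Qed.

Lemma wo_rel_trans : transitive wo_rel.
Proof.
move=> y x z xy yz.
have [|w] := @wo_rel_min [set x; y; z]; first by exists x; left; left.
move=> [[->|->]|->] wle.
- by apply: wle; right.
- have /wo_rel_anti <- // : wo_rel y x && wo_rel x y.
  by rewrite xy wle//; left; left.
- have /wo_rel_anti e : wo_rel z y && wo_rel y z.
    by rewrite yz wle//; left; right.
  by rewrite e.
Qed.

Lemma omega1_le_refl : reflexive omega1_le.
Proof. by move=> x; exact: wo_rel_refl. Qed.

Lemma omega1_le_anti : antisymmetric omega1_le.
Proof. by move=> x y /wo_rel_anti/val_inj. Qed.

Lemma omega1_le_trans : transitive omega1_le.
Proof. by move=> y x z; exact: wo_rel_trans. Qed.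

Lemma omega1_le_total : total omega1_le.
Proof. by move=> x y; exact: wo_rel_total. Qed.

Fact omega1_display : Order.disp_t. Proof. exact: Order.Disp tt tt. Qed.

HB.instance Definition _ := Order.Le_isPOrder.Build omega1_display omega1
  omega1_le_refl omega1_le_anti omega1_le_trans.
HB.instance Definition _ := Order.POrder_isTotal.Build omega1_display omega1
  omega1_le_total.

Definition wf_lt d (W : porderType d) : Prop :=
  well_founded (fun x y : W => (x < y)%O).

Lemma omega1_wf : wf_lt omega1.
Proof.
move=> x; apply: contrapT => nx.
pose A : set (set nat) :=
  [set u | exists2 y : omega1, val y = u &
     ~ Acc (fun x y : omega1 => (x < y)%O) y].
have [|u [y <- ny] yle] := @wo_rel_min A; first by exists (val x), x.
apply: ny; constructor => z zy; apply: contrapT => nz.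
have : (y <= z)%O by apply: yle; exists z.
by rewrite leNgt zy.
Qed.

Lemma omega1_countable_lt (x : omega1) :
  countable [set y : omega1 | (y < x)%O].
Proof.
have cx : countable [set u | wo_rel u (val x)] by case: x => x /= /set_mem.
apply: (card_le_trans _ cx).
apply: (@card_le_trans _ _ _ (val @` [set y : omega1 | (y < x)%O])).
  have : val @` [set y : omega1 | (y < x)%O] #= [set y : omega1 | (y < x)%O].
    by apply: inj_card_eq => u v _ _; exact: val_inj.
  by rewrite card_eq_le => /andP[].
apply: subset_card_le => _ [y yx <-].
exact: (ltW yx).
Qed.

Lemma omega1_uncountable : ~ countable [set: omega1].
Proof.
move=> c.
have cs : countable omega1_set.
  apply: (card_le_trans _ c).
  by have := card_setT omega1_set; rewrite card_eq_le => /andP[].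
have [oT|] := pselect (omega1_set = setT).
  have : countable [set: set nat] by rewrite -oT.
  rewrite /countable => /ppcard_leP[f].
  pose D : set nat := [set n | exists2 S : set nat, f S = n & ~ S n].
  have [Dn|nD] := pselect (D (f D)).
    have [S SD nS] := Dn.
    have e : S = D by apply: (inj (f := f)); rewrite ?inE.
    by apply: nS; rewrite e.
  by apply: (nD); exists D.
move=> nT.
have [|x nx xle] := @wo_rel_min (~` omega1_set).
  by apply/set0P/eqP => e; apply: nT; rewrite -(setCK omega1_set) e setC0.
apply: nx; rewrite /omega1_set/=.
pose F (b : bool) := if b then omega1_set else [set x].
apply: (@sub_countable _ _ _ (\bigcup_(b in setT) F b)).
  apply: subset_card_le => y yx; have [oy|noy] := pselect (omega1_set y).
    by exists true.
  by exists false => //=; apply: wo_rel_anti; rewrite yx xle.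
by apply: bigcup_countable => // -[] _ //=; exact: countable1.
Qed.

(* ω₁·ω₁ has the order type of the lexicographic square of ω₁, the factor read
   first being the right factor of the ordinal product. Its elements
   stand for the ordinals below ω₁·ω₁. *)
Definition omega1_sq := (omega1 *l omega1)%type.

Lemma omega1_sq_wf : wf_lt omega1_sq.
Proof.
case=> a; elim/(well_founded_ind omega1_wf): a => a IHa b.
elim/(well_founded_ind omega1_wf): b => b IHb.
constructor => -[c e].
rewrite ltEprodlexi/= => /andP[]; rewrite le_eqVlt => /predU1P[->|ca _].
  by rewrite lexx => /IHb.
exact: IHa.
Qed.

Section topology_notions.
Variable X : topologicalType.

(* w(X) <= |A|; w(X) is infinite by convention, hence the first conjunct. *)
Definition weight_le T (A : set T) : Prop :=
  infinite_set A /\ exists2 B : set (set X), basis B & B #<= A.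

Definition scattered : Prop :=
  forall A : set X, A !=set0 -> isolated A !=set0.

Definition relatively_discrete (A : set X) : Prop :=
  (nbhs : A -> set_system A) = principal_filter.

Definition sigma_discrete : Prop :=
  exists2 D : nat -> set X,
    (forall n, relatively_discrete (D n)) & \bigcup_n D n = [set: X].

Lemma relatively_discreteP A : relatively_discrete A <-> A `<=` isolated A.
Proof.
split=> [dA x Ax|iA].
  split; first exact/mem_set.
  pose x' : A := SigSub (mem_set Ax).
  have : nbhs x' [set x'] by rewrite dA; exact/principal_filterP.
  move=> [_ [[V oV <-] Vx VA]]; exists V; first exact: open_nbhs_nbhs.
  apply/seteqP; split=> [y [Vy Ay]|y ->//].
  by have /(congr1 val) := VA (SigSub (mem_set Ay)) Vy.
apply/funext => x; apply/seteqP; split=> U.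
  by move=> /nbhs_singleton Ux; exact/principal_filterP.
move=> /principal_filterP Ux.
have [_ [V]] := iA _ (set_valP x).
rewrite nbhsE => -[W [oW Wx] WV] VA.
exists (set_val @^-1` W); split => //=; first by exists W.
move=> y /= Wy.
suff -> : y = x by [].
apply: val_inj; have : (V `&` A) (set_val y).
  by split; [exact: WV|exact: set_valP].
by rewrite VA.
Qed.

Section levels.
Context {d : Order.disp_t} {W : porderType d} (W_wf : wf_lt W).

Definition scattering_level : W -> set X :=
  Fix W_wf (fun=> set X) (fun a level =>
    isolated (~` [set x | exists b (ba : (b < a)%O), level b ba x])).

Lemma scattering_levelE a :
  scattering_level a =
  isolated (~` \bigcup_(b in [set b | (b < a)%O]) scattering_level b).
Proof.
rewrite {1}/scattering_level Fix_eq.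
  congr isolated; congr (~` _); apply/seteqP.
  by split=> x [b]; [case=> ba bx; exists b | exists b; eexists; eassumption].
move=> c f g fg; congr isolated; congr (~` _).
by apply/seteqP; split=> x [b [bc bx]]; exists b, bc; move: bx; rewrite fg.
Qed.

(* The height of X, provided that it is an ordinal of W. *)
Definition is_height (a : W) : Prop :=
  scattering_level a = set0 /\
  forall b, (b < a)%O -> scattering_level b !=set0.

End levels.

Definition height_lt_omega1_sq : Prop :=
  exists a : omega1_sq, is_height omega1_sq_wf a.

End topology_notions.

Definition homeomorphic (X Y : topologicalType) : Prop :=
  exists (f : X -> Y) (g : Y -> X),
    [/\ cancel f g, cancel g f, continuous f & continuous g].

Definition Cp (R : realType) (K : topologicalType) : topologicalType :=
  set_type [set f : {ptws K -> R} | continuous (f : K -> R)].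

(* Main.v *)
(* Give every point x a compact open neighbourhood W x in which all other points
   have smaller Cantor-Bendixson rank; then x in W y and y in W x force x = y.
   If x is in the closure of A, compactness of K produces finitely many
   conditions on points of A and rational intervals that hold at x and only in
   W x; by the antisymmetry of W this finite code determines x. So a set closed
   under countably many finitary operations is topologically closed, and, since
   a base of K of size omega_1 bounds the number of codes, X is an omega_1-chain
   of closed sets with countable differences. Closing off further, every point y
   lying in W q for an earlier q has the same membership as some earlier point
   p(y), its parent, in all the earlier sets W q. Iterating p gives a finite branch; colour
   y by the indices, within their countable stages, of the points of its branch.
   After removing finitely many sets W q from W x one gets a neighbourhood of x
   whose only point with the colour of x is x itself. *)
Require Import Defs.
From Stdlib Require Inverse_Image.
From mathcomp Require Import all_boot all_order all_algebra.
From mathcomp Require Import all_classical all_reals all_analysis.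

Set Implicit Arguments.
Unset Strict Implicit.
Unset Printing Implicit Defensive.

Import Order.TTheory GRing.Theory Num.Theory numFieldNormedType.Exports.

Local Open Scope classical_set_scope.

(** * Compactness and countability tools *)

Lemma compact_seqI (T : topologicalType) (I : eqType) (C : set T) (P : set I)
    (F : I -> set T) : compact C -> (forall i, P i -> closed (F i)) ->
    (forall s : seq I, (forall i, i \in s -> P i) ->
      exists2 t, C t & forall i, i \in s -> F i t) ->
  exists2 t, C t & forall i, P i -> F i t.
Proof.
move=> cC cF fip.
pose D := [set s : seq I | forall i, i \in s -> P i].
pose B (s : seq I) := [set t | C t /\ forall i, i \in s -> F i t].
(* The finite intersections of the [F i] with [C] generate a filter; a cluster point of it in [C]
   lies in every closed [F i]. *)
have DB : ProperFilter (filter_from D B).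
  apply: filter_from_proper; last first.
    by move=> s Ds; have [t Ct Ft] := fip _ Ds; exists t.
  apply: filter_from_filter; first by exists [::].
  move=> s1 s2 D1 D2; exists (s1 ++ s2).
    by move=> i; rewrite mem_cat => /orP[/D1|/D2].
  by move=> t [Ct Ft]; split; split=> // i si; apply: Ft;
    rewrite mem_cat si ?orbT.
have BC : filter_from D B C by exists [::] => // t [].
have [t [Ct tF]] := cC _ DB BC.
exists t => // i Pi; apply: (cF _ Pi) => V Vt.
have : filter_from D B (F i).
  exists [:: i]; first by move=> j; rewrite inE => /eqP ->.
  by move=> z [_]; apply; rewrite inE.
by move=> /tF /(_ Vt).
Qed.

Lemma compact_seq_cover (T : topologicalType) (I : eqType) (C : set T)
    (P : set I) (O : I -> set T) : compact C -> (forall i, P i -> open (O i)) ->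
    (forall t, C t -> exists2 i, P i & O i t) ->
  exists2 s : seq I, (forall i, i \in s -> P i) &
    forall t, C t -> exists2 i, i \in s & O i t.
Proof.
move=> cC oO CO; apply: contrapT => nex.
have [||t Ct nO] := @compact_seqI T I C P (fun i => ~` O i) cC.
- by move=> i Pi; exact/open_closedC/oO.
- move=> s Ps; apply: contrapT => nt; apply: nex; exists s => // t Ct.
  apply: contrapT => nO; apply: nt; exists t => // i si Oi.
  by apply: nO; exists i.
- by have [i Pi Oi] := CO _ Ct; exact: nO Oi.
Qed.

Lemma wf_lt_min d (T : porderType d) (P : set T) : wf_lt T -> P !=set0 ->
  exists2 m, P m & forall y, P y -> ~ (y < m)%O.
Proof.
move=> wf [x]; elim/(well_founded_ind wf): x => x IH Px.
have [[y Py yx]|nex] := pselect (exists2 y, P y & (y < x)%O); first exact: IH Py.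
by exists x => // y Py yx; apply: nex; exists y.
Qed.

Lemma countable_seq_inj (T : Type) (U : eqType) (A : set T) (B : set U)
    (c : T -> seq U) : countable B -> {in A &, injective c} ->
  (forall x u, A x -> u \in c x -> B u) -> countable A.
Proof.
move=> /countable_injP[f finj] cinj cB; apply/countable_injP.
exists (fun x => choice.pickle (map f (c x))) => x y Ax Ay.
move=> /(pcan_inj choice.pickleK) e; apply: cinj => //.
have {Ax} Bx u : u \in c x -> B u by apply: cB; exact: set_mem.
have {Ay} By u : u \in c y -> B u by apply: cB; exact: set_mem.
elim: (c x) (c y) Bx By e => [|a s IH] [|b t]//= Ba Bb [fab fst].
congr (_ :: _).
  by apply: finj fab; apply/mem_set; [apply: Ba | apply: Bb]; rewrite inE eqxx.
by apply: IH => // u us; [apply: Ba | apply: Bb]; rewrite inE us orbT.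
Qed.

Lemma countable_seq (U : eqType) (B : set U) : countable B ->
  countable [set s : seq U | forall u, u \in s -> B u].
Proof.
move=> cB; apply: (@countable_seq_inj _ _ _ B id) => //.
by move=> s u; exact.
Qed.

(** * Compact open neighbourhoods in locally compact scattered spaces *)

Section zero_dimensional_bases.
Context d (Y : porderType d) (X : topologicalType) (rk : X -> Y).
Hypotheses (Y_wf : wf_lt Y) (hX : hausdorff_space X)
  (lcX : locally_compact [set: X])
  (rkX : forall x, \forall y \near x, y = x \/ (rk y < rk x)%O).

(* The boundary of a compact neighbourhood of x consists of points of smaller
   rank, so by induction finitely many compact open sets cover it without x. *)
Lemma compact_open_base x (G : set X) : nbhs x G ->
  exists W : set X, [/\ compact W, open W, W x & W `<=` G].
Proof.
pose Q b := forall x, rk x = b -> forall G, nbhs x G ->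
  exists W : set X, [/\ compact W, open W, W x & W `<=` G].
suff H : forall b, Q b by move=> xG; exact: (H (rk x)).
move=> {x G} b; elim/(well_founded_ind Y_wf): b => b IH x xb G xG.
have [C [xC cC CG Clt]] : exists C, [/\ nbhs x C, compact C, C `<=` G &
    forall y, C y -> y = x \/ (rk y < b)%O].
  have := @lcX x I; rewrite withinET => -[V xV [cV clV]].
  have xR : nbhs x (G `&` [set y | y = x \/ (rk y < b)%O]).
    by apply: filterI => //; rewrite -xb; exact: rkX.
  have [D xD DR] := compact_regular hX cV xV xR.
  exists (V `&` closure D); split.
  - by apply: filterI => //; apply: filterS xD; exact: subset_closure.
  - by apply: compact_closedI => //; exact: closed_closure.
  - by move=> y [_ /DR[]].
  - by move=> y [_ /DR[]].
have cB : compact (C `\` C^°).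
  by apply: compact_closedI => //; apply: open_closedC; exact: open_interior.
have [||s sP sC] := @compact_seq_cover X (set X) _
   [set E | [/\ compact E, open E & ~ E x]] id cB.
- by move=> E [].
- move=> y [Cy nCy].
  have nyx : y <> x by move=> yx; apply: nCy; rewrite yx.
  have ltb : (rk y < b)%O by case: (Clt _ Cy).
  have [|E [cE oE Ey Ex]] := IH _ ltb y erefl (~` [set x]).
    apply: open_nbhs_nbhs; split=> //; apply: closed_openC.
    exact: accessible_closed_set1 (hausdorff_accessible hX) _.
  by exists E => //; split=> // /Ex; apply.
pose E := \bigcup_(F in [set` s]) F.
have oE : open E by apply: bigcup_open => F /sP [].
have nEx : ~ E x by move=> [F /sP[_ _]].
have cE : closed E.
  apply: closed_bigcup => [|F /sP [cF _ _]]; first exact: finite_seq.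
  exact: compact_closed.
exists (C `\` E); split.
- by rewrite setDE; apply: compact_closedI => //; exact: open_closedC.
- have -> : C `\` E = C^° `\` E.
    apply/seteqP; split=> y [Cy nEy]; split=> //.
      apply: contrapT => nCy; have [|F Fs Fy] := sC y; first by split.
      by apply: nEy; exists F.
    exact: interior_subset.
  by apply: openI; [exact: open_interior | exact: closed_openC].
- by split=> //; exact: nbhs_singleton.
- by move=> y [/CG].
Qed.

End zero_dimensional_bases.

(** The rank of a point is the index of its scattering level: near a point isolated in its
    remainder, all other points belong to earlier levels. *)
Lemma height_rank d (Y : orderType d) (Y_wf : wf_lt Y) (X : topologicalType)
    (a : Y) : scattered X -> is_height X Y_wf a ->
  exists rk : X -> Y, forall x, \forall y \near x, y = x \/ (rk y < rk x)%O.
Proof.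
move=> scX [La _].
have ex x : exists b, scattering_level Y_wf b (x : X).
  (* A point in no level would make the remainder at [a] nonempty, so that it would have an isolated
     point although level [a] is empty. *)
  apply: contrapT => nx; move: La; rewrite scattering_levelE.
  apply/eqP/set0P; apply: scX; exists x => -[b _ bx]; apply: nx.
  by exists b.
have levelP b (x : X) : scattering_level Y_wf b x ->
    (forall c, (c < b)%O -> ~ scattering_level Y_wf c x) /\
    \forall y \near x, y = x \/
      exists2 c, (c < b)%O & scattering_level Y_wf c y.
  rewrite scattering_levelE => -[/set_mem nx [V xV VE]]; split.
    by move=> c cb cx; apply: nx; exists c.
  apply: filterS xV => y Vy.
  have [[c cb cy]|ny] := pselect (exists2 c, (c < b)%O &
    scattering_level Y_wf c y); first by right; exists c.
  left; suff : [set x] y by [].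
  by rewrite -VE; split=> // -[c cb cy]; apply: ny; exists c.
pose rk x := projT1 (cid (ex x)).
have rkP x : scattering_level Y_wf (rk x) x := projT2 (cid (ex x)).
exists rk => x; have [_] := levelP _ _ (rkP x).
apply: filterS => y [->|[c cx cy]]; [by left | right].
have : ~~ (c < rk y)%O.
  by apply/negP => cry; have [/(_ _ cry) H _] := levelP _ _ (rkP y); exact: H cy.
have : ~~ (rk y < c)%O.
  by apply/negP => rcy; have [/(_ _ rcy) H _] := levelP _ _ cy; exact: H (rkP y).
by rewrite -!leNgt => h1 h2; rewrite (le_lt_trans h2).
Qed.

Definition compact_open_assignment (X : topologicalType) (W : X -> set X) :=
  [/\ forall x, compact (W x), forall x, open (W x), forall x, W x x &
      forall x y, W x y -> W y x -> x = y].

Lemma scattered_assignment d (Y : orderType d) (Y_wf : wf_lt Y)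
    (X : topologicalType) (a : Y) : hausdorff_space X ->
    locally_compact [set: X] -> scattered X -> is_height X Y_wf a ->
  exists W : X -> set X, compact_open_assignment W.
Proof.
move=> hX lcX scX /(height_rank scX)[rk rkX].
have /choice[W WP] x := compact_open_base Y_wf hX lcX rkX (rkX x).
exists W; split; try by move=> x; have [] := WP x.
move=> x y Wxy Wyx; apply: contrapT => nxy.
have [_ _ _ /(_ _ Wxy) [/esym//|yx]] := WP x.
have [_ _ _ /(_ _ Wyx) [//|xy]] := WP y.
by have := lt_trans xy yx; rewrite ltxx.
Qed.

(** * Countable stages closed under finitary operations *)

Section filtration.
Context (X : choiceType) (G : seq X -> set X) (d0 : X -> omega1).
Hypotheses (cG : forall s, countable (G s))
  (cd0 : forall a, countable [set x | (d0 x <= a)%O]).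

Fixpoint hull_iter (S : set X) (n : nat) : set X :=
  if n is m.+1 then
    hull_iter S m `|` \bigcup_(s in [set s : seq X | forall x, x \in s ->
      hull_iter S m x]) G s
  else S.

Definition hull (S : set X) : set X := \bigcup_n hull_iter S n.

Lemma countable_hull S : countable S -> countable (hull S).
Proof.
move=> cS; apply: bigcup_countable => // n _.
elim: n => //= n IH; rewrite -bigcup2E; apply: bigcup_countable => // -[|[|k]] _ //=.
by apply: bigcup_countable => //; exact: countable_seq.
Qed.

Lemma hullS S T : S `<=` T -> hull S `<=` hull T.
Proof.
move=> ST x [n _ nx]; exists n => //; elim: n x nx => [|n IH] x /=; first exact: ST.
move=> [/IH|[s sn sx]]; [by left | right; exists s => //].
by move=> y ys; apply: IH; exact: sn.
Qed.

Lemma sub_hull S : S `<=` hull S.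
Proof. by move=> x Sx; exists 0. Qed.

Lemma hull_closed S s : (forall x, x \in s -> hull S x) -> G s `<=` hull S.
Proof.
move=> sS z Gz.
suff [n sn] : exists n, forall x, x \in s -> hull_iter S n x.
  by exists n.+1 => //=; right; exists s.
have mono n m : (n <= m)%N -> hull_iter S n `<=` hull_iter S m.
  elim: m => [|m IH]; first by rewrite leqn0 => /eqP ->.
  by rewrite leq_eqVlt => /predU1P[->//|nm] x /(IH nm) nx; left.
elim: s sS {Gz} => [|y s IH] sS; first by exists 0.
have [|n nP] := IH; first by move=> x xs; apply: sS; rewrite inE xs orbT.
have [|m _ my] := sS y; first by rewrite inE eqxx.
exists (maxn n m) => x; rewrite inE => /predU1P[->|xs].
  exact: mono (leq_maxr _ _) _ my.
exact: mono (leq_maxl _ _) _ (nP _ xs).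
Qed.

Lemma omega1_seq_lt (T : eqType) (f : T -> omega1) (s : seq T) a : s != [::] ->
    (forall x, x \in s -> (f x < a)%O) ->
  exists2 b, (b < a)%O & forall x, x \in s -> (f x <= b)%O.
Proof.
elim: s => // y s IH _ sa.
have ya : (f y < a)%O by apply: sa; rewrite inE eqxx.
have [->|s0] := eqVneq s [::].
  by exists (f y) => // x; rewrite inE => /eqP ->.
have [|b ba bP] := IH s0; first by move=> x xs; apply: sa; rewrite inE xs orbT.
exists (Order.max (f y) b); first by rewrite gt_max ya.
move=> x; rewrite inE le_max => /predU1P[->|/bP->]; first by rewrite lexx.
by rewrite orbT.
Qed.

(** [d x] is the least [a] such that [x] lies in the hull of the points with [d0] at most [a]. On a
    nonempty finite [s] below [a], [d] is bounded by some [b] below [a], and the hull at [b] absorbs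
    [G s]. *)
Lemma filtration : exists d : X -> omega1,
  (forall a, countable [set x | (d x <= a)%O]) /\
  forall a s, s != [::] -> (forall x, x \in s -> (d x < a)%O) ->
    forall z, G s z -> (d z < a)%O.
Proof.
pose H a := hull [set x | (d0 x <= a)%O].
have Hmono a b : (a <= b)%O -> H a `<=` H b.
  by move=> ab; apply: hullS => x /= xa; exact: le_trans xa ab.
have /choice[d dP] x : exists a, H a x /\ forall b, H b x -> ~ (b < a)%O.
  have [|a Ha aP] := @wf_lt_min _ _ [set a | H a x] omega1_wf; last by exists a.
  by exists (d0 x); apply: sub_hull => /=.
exists d; split=> [a|a s s0 sa z Gz].
  apply: sub_countable (countable_hull (cd0 a)); apply: subset_card_le => x /= xa.
  by apply: (Hmono _ _ xa); have [] := dP x.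
have [b ba bP] := omega1_seq_lt s0 sa.
rewrite (le_lt_trans _ ba)// leNgt; apply/negP; have [_] := dP z; apply.
apply: hull_closed Gz => x /bP xb.
by apply: (Hmono _ _ xb); have [] := dP x.
Qed.

End filtration.

(** * Parents, branches and the colouring *)

Section coloring.
Context d (Y : orderType d) (X : topologicalType) (W : X -> set X) (dl : X -> Y).
Hypotheses (Y_wf : wf_lt Y) (hX : hausdorff_space X)
  (WP : compact_open_assignment W)
  (countable_dl : forall a, countable [set x | (dl x <= a)%O])
  (closed_dl : forall a, closed [set x | (dl x < a)%O])
  (reflect_dl : forall a s y, s != [::] -> (forall q, q \in s -> (dl q < a)%O) ->
    exists2 p, (dl p < a)%O & forall q, q \in s -> (W q p <-> W q y)).

Let cW x : compact (W x). Proof. by case: WP. Qed.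
Let oW x : open (W x). Proof. by case: WP. Qed.
Let clW x : closed (W x). Proof. exact: compact_closed. Qed.
Let W_refl x : W x x. Proof. by case: WP. Qed.
Let W_anti x y : W x y -> W y x -> x = y. Proof. by case: WP => _ _ _; exact. Qed.

Lemma fiber_index : exists e : X -> nat,
  forall x y, dl x = dl y -> e x = e y -> x = y.
Proof.
have /choice[f fP] a := countable_injP _ (countable_dl a).
exists (fun x => f (dl x) x) => x y xy; rewrite -xy => /fP.
apply; apply/mem_set => //=.
by rewrite xy.
Qed.

Definition below_covered y := exists2 q, (dl q < dl y)%O & W q y.

Definition parent y p :=
  (dl p < dl y)%O /\ forall q, (dl q < dl y)%O -> (W q p <-> W q y).

(** [reflect_dl] treats finitely many sets [W q]. The earlier points of [W q0] form a compact set
    and each condition on [p] is clopen, so one [p] serves all earlier [q]. *)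
Lemma parent_exists y : below_covered y -> exists p, parent y p.
Proof.
move=> [q0 q0y Wq0y].
have [|||p [_ py] pP] := @compact_seqI X X (W q0 `&` [set p | (dl p < dl y)%O])
  [set q | (dl q < dl y)%O] (fun q => [set p | W q p <-> W q y]).
- exact: compact_closedI.
- move=> q _; have [Wqy|nWqy] := pselect (W q y).
    by have -> : [set p | W q p <-> W q y] = W q by apply/seteqP; split=> p /=; tauto.
  have -> : [set p | W q p <-> W q y] = ~` W q by apply/seteqP; split=> p /=; tauto.
  exact: open_closedC.
(* Putting [q0] in front makes the list nonempty and forces [p] into [W q0]. *)
- move=> s sy; have [||p py pP] := @reflect_dl (dl y) (q0 :: s) y => //.
    by move=> q; rewrite inE => /predU1P[->|/sy].
  exists p; last by move=> q qs; apply: pP; rewrite inE qs orbT.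
  by split=> //; apply/pP; rewrite ?inE ?eqxx.
by exists p.
Qed.

Lemma branch_coloring (e : X -> nat) : exists c : X -> seq nat,
  forall y, e y \in c y /\
    (below_covered y -> exists2 p, parent y p & c y = e y :: c p).
Proof.
have /choice[par parP] y : exists p, below_covered y -> parent y p.
  have [/parent_exists[p yp]|ny] := pselect (below_covered y); first by exists p.
  by exists y.
pose R x y := (dl x < dl y)%O.
have R_wf : well_founded R := Inverse_Image.wf_inverse_image _ _ _ dl Y_wf.
(* The test on [R] only makes the recursive call legitimate: if [y] is not below-covered, [par y] is
   arbitrary and nothing is claimed about the tail. *)
pose F y (rec : forall x, R x y -> seq nat) : seq nat :=
  e y :: if pselect (R (par y) y) is left h then rec (par y) h else [::].
exists (Fix R_wf (fun=> seq nat) F) => y.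
have cE : Fix R_wf (fun=> seq nat) F y = F y (fun x _ => Fix R_wf (fun=> seq nat) F x).
  by apply: Fix_eq => x f g fg; rewrite /F; case: pselect => // h; rewrite fg.
rewrite cE /F; split; first by rewrite inE eqxx.
move=> /parP yp; exists (par y) => //.
by case: pselect => // -[]; case: yp.
Qed.

(* The points t are those whose W q is to be removed from W x. *)
Lemma shrink (e : X -> nat) (c : seq nat) x :
    (forall x y, dl x = dl y -> e x = e y -> x = y) ->
  exists t : seq X, [/\ forall q, q \in t -> (dl q <= dl x)%O /\ ~ W q x,
    forall y, W x y -> (dl y < dl x)%O -> exists2 q, q \in t & W q y &
    forall y, W x y -> dl y = dl x -> y <> x -> e y \in c -> y \in t].
Proof.
move=> einj.
(* The earlier part of [W x] is compact and covered by the sets [W q] of its own points; by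
   antisymmetry none of these contains [x]. *)
have [|||t1 t1P t1C] := @compact_seq_cover X X (W x `&` [set p | (dl p < dl x)%O])
  [set q | (dl q < dl x)%O /\ W x q] W.
- exact: compact_closedI.
- by move=> q _.
- by move=> t [xt tx]; exists t.
(* By [einj], each number in [c] is the index of at most one point in the fibre of [dl] through
   [x]. *)
have [t2 [t2P t2C]] : exists t2 : seq X,
    (forall q, q \in t2 -> [/\ dl q = dl x, q <> x & W x q]) /\
    forall y, W x y -> dl y = dl x -> y <> x -> e y \in c -> y \in t2.
  elim: c => [|n c [t2 [t2P t2C]]]; first by exists [::].
  have [[q [qx nqx xq eq]]|nq] := pselect
    (exists q, [/\ dl q = dl x, q <> x, W x q & e q = n]).
    exists (q :: t2); split.
      by move=> q'; rewrite inE => /predU1P[->|/t2P].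
    move=> y xy yx nyx; rewrite !inE => /predU1P[eyn|/t2C->//]; last by rewrite orbT.
    by apply/orP; left; apply/eqP; apply: einj; rewrite ?yx ?qx ?eyn ?eq.
  exists t2; split => // y xy yx nyx; rewrite inE => /predU1P[eyn|]; last exact: t2C.
  by exfalso; apply: nq; exists y.
exists (t1 ++ t2); split.
- move=> q; rewrite mem_cat => /orP[/t1P[qx xq]|/t2P[qx nqx xq]].
    split; first exact: ltW.
    by move=> /(W_anti xq) xE; move: qx; rewrite xE ltxx.
  by rewrite qx lexx; split=> // /(W_anti xq) /esym.
- move=> y xy yx; have [|q qt qy] := t1C y; first by split.
  by exists q => //; rewrite mem_cat qt.
- by move=> y xy yx nyx ey; rewrite mem_cat t2C ?orbT.
Qed.

Lemma sigma_discrete_of_filtration : sigma_discrete X.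
Proof.
have [e einj] := fiber_index.
have [c cP] := branch_coloring e.
have /choice[t tP] x := shrink (c x) x einj.
pose U x := W x `\` \bigcup_(q in [set` t x]) W q.
have U_nbhs x : nbhs x (U x).
  apply: open_nbhs_nbhs; split.
    apply: openI => //; apply: closed_openC.
    by apply: closed_bigcup => //; exact: finite_seq.
  by split=> // -[q /= qt qx]; have [/(_ _ qt)[]] := tP x.
have U_le x y : U x y -> (dl x <= dl y)%O.
  move=> [xy ny]; rewrite leNgt; apply/negP => yx; apply: ny.
  by have [_ /(_ _ xy yx)[q]] := tP x; exists q.
(* Taking parents of z in U x never leaves U x until stage dl x is reached, as x
   and t x belong to earlier stages than the points left behind. *)
have climb x z : U x z -> [\/ z = x, (size (c x) < size (c z))%N |
    exists q, [/\ U x q, q <> x, dl q = dl x & e q \in c z]].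
  move: {2}(dl z) (erefl (dl z)) => b zb.
  elim/(well_founded_ind Y_wf): b z zb => b IH z zb xz.
  have := U_le _ _ xz; rewrite le_eqVlt => /predU1P[xzE|xltz].
    have [->|nzx] := pselect (z = x); first exact: Or31.
    by apply: Or33; exists z; split=> //; case: (cP z).
  have [_ []] := cP z; first by exists x => //; case: xz.
  move=> p [pz pP] cz.
  have xp : U x p.
    case: xz => xz nz; split; first exact/pP.
    move=> [q /= qt qp]; apply: nz; exists q => //=; apply/pP => //.
    by have [/(_ _ qt)[qx _] _ _] := tP x; exact: le_lt_trans qx xltz.
  have pb : (dl p < b)%O by rewrite -zb.
  have [pE|sz|[q [xq nqx qx eq]]] := IH _ pb p erefl xp.
  - by apply: Or32; rewrite cz pE.
  - by apply: Or32; rewrite cz /= ltnS ltnW.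
  - by apply: Or33; exists q; split=> //; rewrite cz inE eq orbT.
(* A strictly longer colour differs from [c x], and a point [q] at stage [dl x] with index in [c x]
   was put into [t x], hence is not in [U x]. *)
have U_color x y : U x y -> c y = c x -> y = x.
  move=> xy cyx; have [//||[q [[xq nq] nqx qx]]] := climb _ _ xy; rewrite cyx.
    by rewrite ltnn.
  move=> eq; exfalso; apply: nq; exists q => //=.
  by have [_ _ H] := tP x; exact: H.
exists (fun n => [set x | choice.pickle (c x) = n]).
  move=> n; apply/relatively_discreteP => x xn; split; first exact/mem_set.
  exists (U x) => //; apply/seteqP; split=> [y [xy yn]|_ ->].
    by apply: U_color => //; apply: (pcan_inj choice.pickleK); rewrite yn.
  by split=> //; exact: nbhs_singleton.
by apply/seteqP; split=> // x _; exists (choice.pickle (c x)).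
Qed.

End coloring.

(** * Rational interval conditions on functions *)

Definition rat_itv (R : realType) (q : rat * rat) : set R :=
  [set r | (ratr q.1 < r)%R /\ (r < ratr q.2)%R].

Lemma rat_itv_nbhs (R : realType) (r : R) (G : set R) : nbhs r G ->
  exists2 q, rat_itv q r & rat_itv q `<=` G.
Proof.
move=> /nbhs_ballP[e /= e0 eG].
have [|q1] := @rat_in_itvoo R (r - e)%R r; first by rewrite ltrBlDr ltrDl.
rewrite in_itv/= => /andP[q1l q1r].
have [|q2] := @rat_in_itvoo R r (r + e)%R; first by rewrite ltrDl.
rewrite in_itv/= => /andP[q2l q2r].
exists (q1, q2) => // t [/= t1 t2]; apply: eG; rewrite -ball_normE /= ltr_distlC.
by rewrite (lt_trans q1l)//= (lt_trans t2).
Qed.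

(** Even the closed interval misses [t], because [closure_determined] applies compactness to closed
    conditions. *)
Lemma rat_itv_sep (R : realType) (r t : R) : r != t ->
  exists2 q, rat_itv q r & ~ (ratr q.1 <= t <= ratr q.2)%R.
Proof.
rewrite neq_lt => /orP[rt|tr].
  have [q1] := @rat_in_itvoo R (r - 1)%R r ltac:(by rewrite ltrBlDr ltrDl).
  have [q2] := rat_in_itvoo rt.
  rewrite !in_itv/= => /andP[q2l q2r] /andP[_ q1r]; exists (q1, q2) => //=.
  by rewrite [X in _ && X]leNgt q2r andbF.
have [q2] := @rat_in_itvoo R r (r + 1)%R ltac:(by rewrite ltrDl).
have [q1] := rat_in_itvoo tr.
rewrite !in_itv/= => /andP[q1l q1r] /andP[q2l _]; exists (q1, q2) => //=.
by rewrite leNgt q1l.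
Qed.

Lemma card_le_inj T U (A : set T) (u0 : U) : (A #<= [set: U])%card ->
  exists f : T -> U, {in A &, injective f}.
Proof.
by elim/Ppointed: U u0 => [U u0|U u0 /pcard_injP//]; first by have := no u0.
Qed.

Lemma rat_itv_open (R : realType) q : open (@rat_itv R q).
Proof. by apply: openI; [exact: open_gt | exact: open_lt]. Qed.

Section function_space.
Context (R : realType) (K X : topologicalType) (ev : X -> K -> R).

(** Together with the continuity of every [ev^~ k], this says that [X] carries the initial topology
    of the evaluations. *)
Definition pointwise_generated := forall x (G : set X), nbhs x G ->
  exists2 s : seq (K * (rat * rat)),
    (forall p, p \in s -> rat_itv p.2 (ev x p.1)) &
    forall y, (forall p, p \in s -> rat_itv p.2 (ev y p.1)) -> G y.

Hypotheses (evK : forall x, continuous (ev x))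
  (evX : forall k, continuous (ev^~ k)) (ev_nbhs : pointwise_generated).

(* The basic open conditions y(k) in J are weakened to y(O) in J, with O taken
   from a small family of sets. *)
Definition network (I : eqType) (O : I -> set K) (L : seq (I * (rat * rat))) : set X :=
  [set y | forall u, u \in L -> forall k, O u.1 k -> rat_itv u.2 (ev y k)].

Lemma network_nbhs (I : choiceType) (O : I -> set K) (P : set I) x (G : set X) :
    (forall k q, rat_itv q (ev x k) -> exists i, [/\ P i, O i k &
      forall k', O i k' -> rat_itv q (ev x k')]) ->
    nbhs x G ->
  exists L, [/\ forall u, u \in L -> P u.1, network O L x & network O L `<=` G].
Proof.
move=> xO /ev_nbhs[s sx sG].
suff [L [LP Lx LG]] : exists L, [/\ forall u, u \in L -> P u.1, network O L x &
    forall y, network O L y -> forall p, p \in s -> rat_itv p.2 (ev y p.1)].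
  by exists L; split=> // y /LG/sG.
elim: s sx {sG} => [|[k q] s IH] sx; first by exists [::].
have [|L [LP Lx LG]] := IH; first by move=> p ps; apply: sx; rewrite inE ps orbT.
have [|i [Pi ik iq]] := xO k q; first by apply: (sx (k, q)); rewrite inE eqxx.
exists ((i, q) :: L); split.
- by move=> u; rewrite inE => /predU1P[->|/LP].
- by move=> u; rewrite inE => /predU1P[->|/Lx].
- move=> y yL p; rewrite inE => /predU1P[->|].
    by apply: (yL (i, q)) => //; rewrite inE eqxx.
  by apply: LG => u uL; apply: yL; rewrite inE uL orbT.
Qed.

(* A function in the closure of A takes equal values at two points of K that A
   does not separate; compactness of K makes this quantitative. *)
Lemma closure_determined (A : set X) x k q : compact [set: K] -> closure A x ->
    rat_itv q (ev x k) ->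
  exists D : seq (X * (rat * rat)),
    [/\ forall p, p \in D -> A p.1, forall p, p \in D -> rat_itv p.2 (ev p.1 k) &
      forall k', (forall p, p \in D -> rat_itv p.2 (ev p.1 k')) ->
        rat_itv q (ev x k')].
Proof.
move=> cK Ax xq; apply: contrapT => nD.
(* If no finite [D] works, some [t] has [ev x t] outside [q], while each member of [A] satisfies at
   [t] the closed form of every rational condition that it satisfies at [k]. *)
have [|||t [_ nt] tP] := @compact_seqI K (X * (rat * rat))%type
  ([set: K] `&` ev x @^-1` (~` rat_itv q))
  [set p | A p.1 /\ rat_itv p.2 (ev p.1 k)]
  (fun p => ev p.1 @^-1` [set r | (ratr p.2.1 <= r)%R /\ (r <= ratr p.2.2)%R]).
- apply: compact_closedI => //; apply: closed_comp => [? _|]; first exact: evK.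
  exact/open_closedC/rat_itv_open.
- move=> p _; apply: closed_comp => [? _|]; first exact: evK.
  by apply: closedI; [exact: closed_ge | exact: closed_le].
- move=> s sP; apply: contrapT => ns; apply: nD; exists s.
  split=> [p /sP[]//|p /sP[]//|k' k's].
  apply: contrapT => nk'; apply: ns; exists k' => // p /k's [p1 p2].
  by split; exact: ltW.
have at_ a : A a -> ev a t = ev a k.
  move=> Aa; apply/eqP/negPn/negP; rewrite eq_sym => tk.
  have [q' q'k q'n] := rat_itv_sep tk.
  by have [//|l r] := tP (a, q'); apply: q'n; rewrite l r.
apply: nt; suff -> : ev x t = ev x k by [].
(* Agreement of the values at [t] and [k] is a closed condition, so it passes from [A] to [x]. *)
have /closure_id cE : closed [set z | ev z t = ev z k].
  have -> : [set z | ev z t = ev z k] = (fun z => (ev z t - ev z k)%R) @^-1` [set 0%R].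
    by apply/seteqP; split=> z /= [zE]; [rewrite zE subrr | exact: subr0_eq].
  apply: closed_comp => [z _|]; last exact: closed_eq.
  by apply: cvgB; exact: evX.
by suff : [set z | ev z t = ev z k] x by []; rewrite cE; apply: closureS Ax => a /at_.
Qed.

(** A finite code of base sets of [K] and rational intervals determines [x], by antisymmetry of [W].
    As initial segments of [omega1] are countable, only countably many codes have their base sets
    indexed up to [a]. *)
Lemma countable_levels (W : X -> set X) :
    weight_le K [set: omega1] -> compact_open_assignment W ->
  exists d0 : X -> omega1, forall a, countable [set x | (d0 x <= a)%O].
Proof.
move=> [inf [B [oB Bnbhs] jB]] [_ oW Wx Wanti].
have [a0 _] := infinite_setN0 inf.
have [j jinj] := card_le_inj a0 jB.
have /choice[c cP] x : exists L : seq (set K * (rat * rat)),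
    [/\ forall u, u \in L -> B u.1, network id L x & network id L `<=` W x].
  apply: network_nbhs; last exact: open_nbhs_nbhs.
  move=> k q xk; have [|b [Bb bk] bq] := Bnbhs k (ev x @^-1` rat_itv q).
    by apply: evK; apply: open_nbhs_nbhs; split=> //; exact: rat_itv_open.
  by exists b; split.
have cinj : injective c.
  move=> x y xy; have [_ xn nx] := cP x; have [_ yn ny] := cP y.
  by apply: Wanti; [apply: nx; rewrite xy | apply: ny; rewrite -xy].
(* This is the largest index of a base set in the code of [x], or [a0] if that is larger; [a0] also
   serves the empty code. *)
exists (fun x => foldr (fun u a => Order.max (j u.1) a) a0 (c x)) => a.
pose Ba := [set u : set K * (rat * rat) | B u.1 /\ (j u.1 <= a)%O].
have cBa : countable Ba.
  have -> : Ba = [set b | B b /\ (j b <= a)%O] `*` [set: rat * rat].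
    by apply/seteqP; split=> -[b q] //= [[]].
  apply: countableX => //.
  have /countable_injP[f finj] : countable [set b : omega1 | (b <= a)%O].
    have -> : [set b : omega1 | (b <= a)%O] = [set a] `|` [set b | (b < a)%O].
      apply/seteqP; split=> b /=; first by rewrite le_eqVlt => /predU1P.
      by move=> [->|/ltW].
    rewrite -bigcup2E; apply: bigcup_countable => // -[|[|n]] _ //=.
    exact: omega1_countable_lt.
  apply/countable_injP; exists (f \o j) => b b' /set_mem[Bb ba] /set_mem[Bb' b'a].
  move=> fe; apply: jinj; [exact/mem_set | exact/mem_set |].
  by apply: finj fe; exact/mem_set.
apply: (countable_seq_inj cBa (c := c)); first by move=> x y _ _; exact: cinj.
move=> x u /= xa uc; split; first by have [+ _ _] := cP x; exact.
elim: (c x) xa uc => // v L IH /=; rewrite ge_max => /andP[va La].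
by rewrite inE => /predU1P[->|/IH]; [|exact].
Qed.

End function_space.

(** * Codes built from points of the space, and closing off *)

Section closing_off.
Context (R : realType) (K X : topologicalType) (ev : X -> K -> R) (W : X -> set X).
Hypotheses (cK : compact [set: K])
  (evK : forall x, continuous (ev x)) (evX : forall k, continuous (ev^~ k))
  (ev_nbhs : pointwise_generated ev) (WP : compact_open_assignment W).

Definition cell (D : seq (X * (rat * rat))) : set K :=
  [set k | forall p, p \in D -> rat_itv p.2 (ev p.1 k)].

(* By antisymmetry of W, the code L determines x. *)
Definition coded_by (s : seq X) : set X :=
  [set x | exists L : seq (seq (X * (rat * rat)) * (rat * rat)),
    [/\ forall u, u \in L -> forall p, p \in u.1 -> p.1 \in s,
    network ev cell L x & network ev cell L `<=` W x]].

Lemma countable_coded_by s : countable (coded_by s).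
Proof.
have /choice[c cP] (x : X) :
    exists L : seq (seq (X * (rat * rat)) * (rat * rat)), coded_by s x ->
    [/\ forall u, u \in L -> forall p, p \in u.1 -> p.1 \in s,
      network ev cell L x & network ev cell L `<=` W x].
  have [[L LP]|nx] := pselect (coded_by s x); first by exists L.
  by exists [::].
pose B1 := [set p : X * (rat * rat) | p.1 \in s].
have cB1 : countable B1.
  have -> : B1 = [set` s] `*` [set: rat * rat].
    by apply/seteqP; split=> -[a q] //= [].
  by apply: countableX => //; exact/finite_set_countable/finite_seq.
pose B2 := [set u : seq (X * (rat * rat)) * (rat * rat) |
  forall p, p \in u.1 -> B1 p].
have cB2 : countable B2.
  have -> : B2 = [set D | forall p, p \in D -> B1 p] `*` [set: rat * rat].
    by apply/seteqP; split=> -[D q] //= [].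
  by apply: countableX => //; exact: countable_seq.
apply: (countable_seq_inj cB2 (c := c)).
  move=> x y /set_mem xs /set_mem ys xy.
  have [_ xn nx] := cP _ xs; have [_ yn ny] := cP _ ys.
  case: WP => _ _ _ Wanti.
  by apply: Wanti; [apply: nx; rewrite xy | apply: ny; rewrite -xy].
by move=> x u /cP[cs _ _] uc p; exact: cs uc _.
Qed.

(** For [x] in the closure of [A], [closure_determined] supplies cells built from points of [A]. A
    code inside [W x] mentions finitely many of them, and [x] is coded by these. *)
Lemma closed_of_coded (A : set X) : A !=set0 ->
    (forall s, s != [::] -> (forall x, x \in s -> A x) -> coded_by s `<=` A) ->
  closed A.
Proof.
move=> [a0 Aa0] As x Ax; case: WP => _ oW Wx _.
have [||L [LA Lx LW]] := @network_nbhs _ _ _ _ ev_nbhs _ cell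
  [set D | forall p, p \in D -> A p.1] x (W x).
- move=> k q xq; have [D [DA Dk Dq]] := closure_determined evK evX cK Ax xq.
  by exists D; split.
- exact: open_nbhs_nbhs.
(* [a0] keeps the list nonempty even if the code mentions no point. *)
apply: (As (a0 :: flatten [seq [seq p.1 | p <- u.1] | u <- L])) => //.
  move=> y; rewrite inE => /predU1P[->//|/flattenP[_ /mapP[u uL ->]]].
  by move=> /mapP[p pu ->]; exact: LA uL _ pu.
exists L; split=> // u uL p pu; rewrite inE; apply/orP; right.
by apply/flattenP; exists [seq p.1 | p <- u.1]; apply: map_f.
Qed.

Lemma pattern_representatives (T : Type) (U : countType) (f : T -> U) :
  exists2 C : set T, countable C & forall y, exists2 p, C p & f p = f y.
Proof.
have /choice[g gP] (u : U) : exists g : set T, countable g /\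
    forall y, f y = u -> exists2 p, g p & f p = u.
  have [[y yu]|nu] := pselect (exists y, f y = u).
    by exists [set y]; split=> [|_ _]; [exact: countable1 | by exists y].
  by exists set0; split=> // y yu; exfalso; apply: nu; exists y.
exists (\bigcup_u g u); first by apply: bigcup_countable => // u _; case: (gP u).
by move=> y; have [_ /(_ y erefl)[p gp pE]] := gP (f y); exists p => //; exists (f y).
Qed.

Lemma sigma_discrete_pointwise_generated :
    weight_le K [set: omega1] -> hausdorff_space X -> sigma_discrete X.
Proof.
move=> wK hX.
have [d0 d0P] := countable_levels evK ev_nbhs wK WP.
have /choice[C CP] (s : seq X) : exists C : set X, countable C /\ forall y,
    exists2 p, C p & forall q, q \in s -> (W q p <-> W q y).
  have [C cC CP] := pattern_representatives (fun y => [seq `[<W q y>] | q <- s]).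
  exists C; split=> // y; have [p Cp /eq_in_map pE] := CP y.
  by exists p => // q /pE; exact: asbool_eq_equiv.
(* Absorbing [coded_by s] makes the initial segments closed; absorbing [C s] yields the reflection
   of finite membership patterns. *)
have [|dl [cdl dlP]] := @filtration X (fun s => coded_by s `|` C s) d0 _ d0P.
  move=> s; rewrite -bigcup2E; apply: bigcup_countable => // -[|[|n]] _ //=.
    exact: countable_coded_by.
  by case: (CP s).
apply: (sigma_discrete_of_filtration omega1_wf hX WP cdl).
- move=> a; have [->|/set0P A0] := eqVneq [set x | (dl x < a)%O] set0.
    exact: closed0.
  apply: closed_of_coded => // s s0 sA z zs.
  by apply: dlP s0 sA _ _; left.
- move=> a s y s0 sa; have [_ /(_ y)[p Cp pP]] := CP s.
  by exists p => //; apply: dlP s0 sa _ _; right.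
Qed.

End closing_off.

(** * Evaluation on a subspace of [Cp], and the conclusion *)

Lemma subtype_nbhs (T : topologicalType) (A : set T) (a : A) (U : set A) :
  nbhs a U -> exists2 V, nbhs (val a) V & val @^-1` V `<=` U.
Proof.
move=> [_ [[V oV <-] Va VU]]; exists V => //.
exact: open_nbhs_nbhs.
Qed.

Section Cp_evaluation.
Context (R : realType) (K X : topologicalType) (A : set (Cp R K))
  (f : X -> A) (g : A -> X).
Hypotheses (fK : cancel f g) (cf : continuous f) (cg : continuous g).

Definition Cp_eval (x : X) : {ptws K -> R} := val (val (f x)).

Lemma Cp_eval_continuous x : continuous (Cp_eval x : K -> R).
Proof. exact: set_valP (val (f x)). Qed.

Lemma Cp_eval_ptws_continuous : continuous Cp_eval.
Proof.
move=> x; apply: (@continuous_comp _ _ _ (val \o f) val).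
  apply: continuous_comp; first exact: cf.
  exact: initial_continuous.
exact: initial_continuous.
Qed.

Lemma Cp_eval_continuousl k : continuous (Cp_eval^~ k).
Proof.
move=> x; have /pointwise_cvgP := @Cp_eval_ptws_continuous x.
exact.
Qed.

Lemma Cp_eval_generated : pointwise_generated Cp_eval.
Proof.
move=> x G xG; have : nbhs (f x) (g @^-1` G) by apply: cg; rewrite fK.
move=> /subtype_nbhs[V Vx VG].
have [V' V'x V'V] := subtype_nbhs Vx.
pose D := [set s : seq (K * (rat * rat)) |
  forall p, p \in s -> rat_itv p.2 (Cp_eval x p.1)].
pose B (s : seq (K * (rat * rat))) := [set y |
  forall p, p \in s -> rat_itv p.2 (Cp_eval y p.1)].
have FF : Filter (filter_from D B).
  apply: filter_from_filter; first by exists [::].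
  move=> s1 s2 D1 D2; exists (s1 ++ s2).
    by move=> p; rewrite mem_cat => /orP[/D1|/D2].
  by move=> y yB; split=> p ps; apply: yB; rewrite mem_cat ps ?orbT.
(* The finite rational conditions true at [x] generate a filter whose image converges pointwise to
   [Cp_eval x], so finitely many of them force the image into [V']. *)
have : {ptws, Cp_eval @ filter_from D B --> Cp_eval x}.
  apply/pointwise_cvgP => k U /rat_itv_nbhs[q xq qU].
  exists [:: (k, q)]; first by move=> p; rewrite inE => /eqP ->.
  by move=> y /(_ (k, q)); rewrite inE eqxx => /(_ isT) /qU.
move=> /(_ _ V'x)[s Ds sV]; exists s => // y ys.
by rewrite -(fK y); apply/VG/V'V/sV.
Qed.

Lemma Cp_eval_hausdorff : hausdorff_space X.
Proof.
have inj : injective Cp_eval by move=> x y /val_inj/val_inj/(can_inj fK).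
move=> x y xy; apply: inj; apply/funext => k.
apply: (@Rhausdorff R) => U V Ux Vy.
have [z [Uz Vz]] := xy _ _ (Cp_eval_continuousl Ux) (Cp_eval_continuousl Vy).
by exists (Cp_eval z k).
Qed.

End Cp_evaluation.

Theorem theorem1p4 (R : realType) (K X : topologicalType)
    (K_compact : compact [set: K]) (K_hausdorff : hausdorff_space K)
    (K_weight : weight_le K [set: omega1])
    (X_Cp : exists A : set (Cp R K), homeomorphic X A)
    (X_lc : locally_compact [set: X])
    (X_scattered : scattered X)
    (X_height : height_lt_omega1_sq X) :
  sigma_discrete X.
Proof.
have [A [f [g [fK _ cf cg]]]] := X_Cp.
have hX := Cp_eval_hausdorff fK cf.
have [a aX] := X_height.
have [W WP] := scattered_assignment hX X_lc X_scattered aX.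
exact: sigma_discrete_pointwise_generated K_compact
  (@Cp_eval_continuous _ _ _ _ f) (Cp_eval_continuousl cf)
  (Cp_eval_generated fK cg) WP K_weight hX.
Qed.
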